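(* The polynomial $p_t(K)=\sum_d \mathrm{sgn}(d)\,t^{|i(d)|}\in\mathbb{Z}[t]$, where the sum is over all classical crossings $d$ of a diagram $K$, is an invariant of framed virtual knots, and it is a Vassiliev invariant of order one.
   Context: A virtual knot diagram is a generic immersion of an oriented circle in the plane, each double point being decorated either as a classical crossing (with over/under information, hence a sign $\mathrm{sgn}=\pm1$) or as a virtual crossing. Framed virtual knots are diagrams modulo the classical Reidemeister moves 2, 3, the purely virtual Reidemeister moves 1, 2, 3, the mixed move (sliding an arc carrying only virtual crossings past a classical crossing), and the framed Reidemeister move 1, which inserts or removes on an arc two consecutive kinks whose classical crossings have opposite signs. For a classical crossing $d$ of $K$, smooth $d$ according to orientation to obtain a two-component virtual link, and forget the over/under information. Choose an ordering $\{1,2\}$ of the two components. For a classical crossing $x$ between the two components ($x\in 1\cap2$) let $\mathrm{sgn}(x)=+1$ if the tangent vectors at $x$ (of component 1, of component 2), in this order, form a positively oriented basis of the plane, and $-1$ otherwise. The intersection index is $i(d)=\sum_{x\in1\cap2}\mathrm{sgn}(x)$; changing the ordering changes only its sign, so $|i(d)|$ is well defined. A knot invariant $\nu$ with values in an abelian group is extended to singular virtual knots (virtual knots with transverse double points, up to the classical Reidemeister moves 2, 3, the purely virtual Reidemeister moves 1, 2, 3, the mixed move, the framed Reidemeister move 1, and rigid vertex isotopy) by $\nu(K_\bullet)=\nu(K_+)-\nu(K_-)$, where $K_\pm$ replace a double point by a positive/negative crossing. It is a Vassiliev (finite-type) invariant of order $\le n$ if it vanishes on all knots with more than $n$ double points;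 it has order one if it has order $\le1$ but is not of order $\le0$, i.e. it is nonzero on some knot with exactly one double point. *)

(* Defs.v *)
From HB Require Import structures.
From mathcomp Require Import all_boot all_order all_algebra.
From Stdlib Require Import Relations.Relation_Operators.

Set Implicit Arguments.
Unset Strict Implicit.
Unset Printing Implicit Defensive.

Import Order.TTheory GRing.Theory Num.Theory.
Local Open Scope ring_scope.

(* A generic immersion of an oriented circle, up to ambient isotopy, is encoded
   by the combinatorial map it draws.  Following the curve once around from a
   base point, one records every passage through a double point; a diagram is
   thus a cyclic word of [pass]es in which each double point occurs twice.
   All double points are recorded: classical crossings, virtual crossings and
   the rigid double points of singular knots.  The map is drawn on the sphere,
   no region being marked as unbounded: carrying an arc across infinity replaces
   it by another arc without crossings, which is an instance of the detour move
   and thus a consequence of the virtual, mixed and rigid vertex moves. *)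

Inductive role := Over | Under | Virtual | Double.

Definition opp (r : role) : role :=
  match r with
  | Over => Under | Under => Over | Virtual => Virtual | Double => Double
  end.

Definition is_over (r : role) : bool := if r is Over then true else false.
Definition is_virtual (r : role) : bool := if r is Virtual then true else false.
Definition is_double (r : role) : bool := if r is Double then true else false.
Definition is_classical (r : role) : bool :=
  match r with Over | Under => true | _ => false end.

(* [frame] holds when (tangent of the branch being followed, tangent of the
   other branch) is a positively oriented basis of the plane; the two passes
   through a double point therefore carry opposite frames.  [kind] is the
   decoration as seen from the branch being followed. *)
Record pass := Pass { lab : nat; frame : bool; kind : role }.

Definition code := seq pass.

Definition complementary (r s : role) : bool :=
  match r, s with
  | Over, Under | Under, Over | Virtual, Virtual | Double, Double => true
  | _, _ => false
  end.

Definition well_formed (w : code) : bool :=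
  all (fun x => if [seq p <- w | lab p == x] is [:: p; q]
                then (frame p != frame q) && complementary (kind p) (kind q)
                else false)
      [seq lab p | p <- w].

(* The underlying combinatorial map.  With m passes, edge i : 'I_m runs from
   pass i to the next pass, and the dart (i, b) is edge i traversed forwards
   (b = true) or backwards.  At each vertex [face_step] turns left, so its
   orbits are the boundaries of the complementary regions. *)
Section Planarity.

Variable s : seq (nat * bool).
Let m := size s.
Let label (i : nat) := (nth (0%N, false) s i).1.
Let fr (i : nat) := (nth (0%N, false) s i).2.

Definition other_pass (i : 'I_m) : 'I_m :=
  odflt i [pick j : 'I_m | (j != i) && (label j == label i)].

Definition leave (i : 'I_m) (forwards : bool) : 'I_m * bool :=
  if forwards then (i, true) else (ord_pred i, false).

Definition face_step (d : 'I_m * bool) : 'I_m * bool :=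
  let: (i, b) := d in
  if b then leave (other_pass (ordS i)) (fr (ordS i))
  else leave (other_pass i) (~~ fr i).

Definition n_faces : nat := fcard face_step predT.

(* Euler's formula V - E + F = 2 with V = m / 2 and E = m; the curve is
   connected.  A circle without double points has no dart and is planar. *)
Definition genus0 : bool := (m == 0)%N || (n_faces == m./2 + 2)%N.

End Planarity.

Definition shadow (w : code) : seq (nat * bool) :=
  [seq (lab p, frame p) | p <- w].

Record sdiagram := SDiagram {
  word :> code;
  _ : well_formed word && genus0 (shadow word) }.

Definition crossings (P : pred role) (w : code) : seq nat :=
  undup [seq lab p | p <- w & P (kind p)].

Definition n_double (w : code) : nat := size (crossings is_double w).

(* Singular diagrams without double points. *)
Definition diagram := {K : sdiagram | n_double K == 0%N}.

Definition word_of (K : diagram) : code := word (val K).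

(** * Moves *)

Definition relabel (f : nat -> nat) (p : pass) : pass :=
  Pass (f (lab p)) (frame p) (kind p).

Definition along (d : bool) (w : code) : code := if d then w else rev w.

(* As a crossing sign, [true] is +1: (over, under) is a positive basis. *)
Definition pass_sign (e : bool) (r : role) : bool := e == is_over r.

Definition kink (a : nat) (e : bool) (r : role) : code :=
  [:: Pass a e r; Pass a (~~ e) (opp r)].

(* The branches of a bigon with corners a and b; [r] is the role of the first
   branch at both corners.  The frames at a and b are opposite because the
   second branch crosses the first one back and forth. *)
Definition bigon1 (a b : nat) (e : bool) (r : role) : code :=
  [:: Pass a e r; Pass b (~~ e) r].
Definition bigon2 (a b : nat) (e : bool) (r : role) : code :=
  [:: Pass a (~~ e) (opp r); Pass b e (opp r)].

(* The branches of a triangle with corners a = 1/\2, b = 1/\3, c = 2/\3, where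
   rij is the role of branch i at its crossing with branch j.  When the three
   branches run a-b, a-c, b-c respectively, the triangle is a complementary
   region exactly when the frames (1,2), (1,3), (2,3) agree (their value is e);
   di tells whether branch i runs in that direction, and reversing one branch
   of a crossing reverses its frame. *)
Section Triangle.

Variables (a b c : nat) (e d1 d2 d3 : bool) (r12 r13 r23 : role).

Definition tri1 : code :=
  along d1 [:: Pass a (e (+) d1 (+) d2) r12; Pass b (e (+) d1 (+) d3) r13].
Definition tri2 : code :=
  along d2 [:: Pass a (~~ (e (+) d1 (+) d2)) (opp r12);
               Pass c (e (+) d2 (+) d3) r23].
Definition tri3 : code :=
  along d3 [:: Pass b (~~ (e (+) d1 (+) d3)) (opp r13);
               Pass c (~~ (e (+) d2 (+) d3)) (opp r23)].

End Triangle.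

Definition above (h k : nat) : role := if (k < h)%N then Over else Under.

Inductive tri_roles : role -> role -> role -> Prop :=
| Tri_classical h1 h2 h3 of uniq [:: h1; h2; h3] :
    tri_roles (above h1 h2) (above h1 h3) (above h2 h3)
| Tri_virtual : tri_roles Virtual Virtual Virtual
| Tri_mixed1 r of is_classical r : tri_roles Virtual Virtual r
| Tri_mixed2 r of is_classical r : tri_roles Virtual r Virtual
| Tri_mixed3 r of is_classical r : tri_roles r Virtual Virtual.

(* Branch 1, 2 or 3 slides over, under, or virtually past a rigid vertex. *)
Inductive tri_rigid_roles : role -> role -> role -> Prop :=
| Tri_rigid1 r of ~~ is_double r : tri_rigid_roles r r Double
| Tri_rigid2 r of ~~ is_double r : tri_rigid_roles (opp r) Double r
| Tri_rigid3 r of ~~ is_double r : tri_rigid_roles Double r r.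

(* Since words may be rotated, each local move is written with the base point
   just before its first branch.  Labels introduced by a move are fresh because
   both sides are required to be well formed.  Likewise both sides are required
   to be planar; in particular a bigon can only be created between two arcs on
   the boundary of a common region. *)
Inductive framed_move : code -> code -> Prop :=
| Base_point k w : framed_move w (rot k w)
| Relabel f w of injective f : framed_move w [seq relabel f p | p <- w]
| Framed_R1 a b e1 e2 r1 r2 w
    of is_classical r1 & is_classical r2
    & pass_sign e1 r1 != pass_sign e2 r2 :
    framed_move (kink a e1 r1 ++ kink b e2 r2 ++ w) w
| Virtual_R1 a e w : framed_move (kink a e Virtual ++ w) w
| Move_R2 a b e d r u v of is_classical r || is_virtual r :
    framed_move (bigon1 a b e r ++ u ++ along d (bigon2 a b e r) ++ v) (u ++ v)
| Move_R3 a b c e d1 d2 d3 r12 r13 r23 u v w of tri_roles r12 r13 r23 :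
    let t1 := tri1 a b e d1 d2 d3 r12 r13 in
    let t2 := tri2 a c e d1 d2 d3 r12 r23 in
    let t3 := tri3 b c e d1 d2 d3 r13 r23 in
    framed_move (t1 ++ u ++ t2 ++ v ++ t3 ++ w)
                (rev t1 ++ u ++ rev t2 ++ v ++ rev t3 ++ w).

(* [Rigid_twist]: a half turn of the rigid vertex x carries an adjacent crossing
   a of its two branches to the other side, preserving the sign of a. *)
Inductive rigid_move : code -> code -> Prop :=
| Rigid_slide a b c e d1 d2 d3 r12 r13 r23 u v w
    of tri_rigid_roles r12 r13 r23 :
    let t1 := tri1 a b e d1 d2 d3 r12 r13 in
    let t2 := tri2 a c e d1 d2 d3 r12 r23 in
    let t3 := tri3 b c e d1 d2 d3 r13 r23 in
    rigid_move (t1 ++ u ++ t2 ++ v ++ t3 ++ w)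
               (rev t1 ++ u ++ rev t2 ++ v ++ rev t3 ++ w)
| Rigid_twist a x e d r u v of is_classical r :
    rigid_move
      ([:: Pass a e r; Pass x (~~ e) Double] ++ u ++
       along d [:: Pass a (~~ e) (opp r); Pass x e Double] ++ v)
      ([:: Pass x e Double; Pass a (~~ e) (opp r)] ++ u ++
       along d [:: Pass x (~~ e) Double; Pass a e r] ++ v).

(* Two diagrams represent the same framed virtual knot. *)
Definition framed_equiv : diagram -> diagram -> Prop :=
  clos_refl_sym_trans diagram
    (fun K L => framed_move (word_of K) (word_of L)).

(* Two singular diagrams represent the same singular virtual knot. *)
Definition singular_equiv : sdiagram -> sdiagram -> Prop :=
  clos_refl_sym_trans sdiagram
    (fun K L => framed_move (word K) (word L) \/ rigid_move (word K) (word L)).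

Definition framed_invariant (T : Type) (nu : diagram -> T) : Prop :=
  forall K L, framed_equiv K L -> nu K = nu L.

(** * Finite-type invariants *)

(* [s = true] gives the positive crossing. *)
Definition resolve_word (x : nat) (s : bool) (w : code) : code :=
  [seq if lab p == x
       then Pass x (frame p) (if frame p == s then Over else Under)
       else p | p <- w].

Lemma shadow_resolve x s w : shadow (resolve_word x s w) = shadow w.
Proof.
rewrite /shadow /resolve_word -map_comp; apply: eq_map => p /=.
by case: eqP => // <-.
Qed.

Lemma well_formed_resolve x s w :
  well_formed w -> well_formed (resolve_word x s w).
Proof.
pose g p := if lab p == x
  then Pass x (frame p) (if frame p == s then Over else Under) else p.
have lab_g p : lab (g p) = lab p by rewrite /g; case: eqP.
rewrite /well_formed -[resolve_word x s w]/(map g w) -map_comp.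
rewrite (eq_map (lab_g : lab \o g =1 lab)) => /allP wfw; apply/allP => y wy.
rewrite filter_map (eq_filter (a2 := fun p => lab p == y)); last first.
  by move=> p /=; rewrite lab_g.
have := wfw y wy; have: all (fun p => lab p == y) [seq p <- w | lab p == y].
  exact: filter_all.
case: [seq p <- w | lab p == y] => [|p [|q []]] //=.
rewrite andbT => /andP[/eqP py /eqP qy]; rewrite /g py qy.
by case: (y == x) => // /andP[]; case: (frame p) (frame q) s {g lab_g} => [] [] [].
Qed.

Lemma resolve_subproof x s (K : sdiagram) :
  well_formed (resolve_word x s K) && genus0 (shadow (resolve_word x s K)).
Proof.
by case: K => w /andP[wfw gw] /=; rewrite shadow_resolve gw well_formed_resolve.
Qed.

Definition resolve (x : nat) (s : bool) (K : sdiagram) : sdiagram :=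
  SDiagram (resolve_subproof x s K).

(* The extension of [nu] to singular virtual knots; it is unique. *)
Record is_extension (G : zmodType) (nu : diagram -> G) (V : sdiagram -> G) :
    Prop := IsExtension {
  ext_invariant : forall K L, singular_equiv K L -> V K = V L;
  ext_agrees : forall K : diagram, V (val K) = nu K;
  ext_skein : forall (K : sdiagram) (x : nat), x \in crossings is_double K ->
    V K = V (resolve x true K) - V (resolve x false K) }.

Definition vassiliev_order_le (G : zmodType) (n : nat) (nu : diagram -> G) :
    Prop :=
  exists2 V : sdiagram -> G, is_extension nu V &
    forall K : sdiagram, (n < n_double K)%N -> V K = 0.

Definition vassiliev_order_one (G : zmodType) (nu : diagram -> G) : Prop :=
  vassiliev_order_le 1 nu /\ ~ vassiliev_order_le 0 nu.

(** * The polynomial *)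

(* Rotating w to d A d B, the oriented smoothing at d has the two (cyclic)
   components A and B. *)
Definition smoothing (d : nat) (w : code) : code * code :=
  let s := behead (rot (find (fun p => lab p == d) w) w) in
  let j := find (fun p => lab p == d) s in
  (take j s, drop j.+1 s).

Definition intersection_index (d : nat) (w : code) : int :=
  let: (A, B) := smoothing d w in
  \sum_(p <- A | is_classical (kind p) && (lab p \in [seq lab q | q <- B]))
     (if frame p then 1 else - 1).

Definition crossing_sign (d : nat) (w : code) : int :=
  if has (fun p => (lab p == d) && is_over (kind p) && frame p) w
  then 1 else - 1.

Definition p_t (K : diagram) : {poly int} :=
  \sum_(d <- crossings is_classical (word_of K))
     crossing_sign d (word_of K) *: 'X^(absz (intersection_index d (word_of K))).

(* Main.v *)
Require Import Defs.
From HB Require Import structures.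
From mathcomp Require Import all_boot all_order all_algebra.
From mathcomp Require Import zify.

Set Implicit Arguments.
Unset Strict Implicit.
Unset Printing Implicit Defensive.

Import Order.TTheory GRing.Theory Num.Theory.
Local Open Scope ring_scope.

(* The index of a crossing x is the sum of the signs of the classical passes met
   between the two passes of x: a crossing of that arc with itself contributes
   twice, with opposite signs.  The index is thus additive along the word, and
   words related by a move can be compared crossing by crossing.  The crossings
   created by R1 have index 0 and opposite signs, those created by R2 have the
   same index and opposite signs; under R3, a crossing of the triangle trades one
   of the two other corners for the other with the same sign, or meets both or
   none of them.

   The index does not depend on the over/under information, so p_t increases by
   2 t^|i(x)| when the crossing x goes from negative to positive, whatever the
   other crossings are.  Hence p_t extends by 2 t^|i(x)| to knots with a single
   double point x, and by 0 to knots with more double points. *)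

(** * Passes as an equality type, and sums grouped by label *)

(** The last two booleans code the four roles, which embeds passes in a product of equality
    types. *)
Definition pass_tuple (p : pass) : nat * bool * (bool * bool) :=
  (lab p, frame p, (is_classical (kind p), is_over (kind p) || is_double (kind p))).

Definition tuple_pass (t : nat * bool * (bool * bool)) : pass :=
  let: (x, e, (c, o)) := t in
  Pass x e (if c then if o then Over else Under
            else if o then Double else Virtual).

Lemma pass_tupleK : cancel pass_tuple tuple_pass.
Proof. by case=> x e []. Qed.

HB.instance Definition _ := Equality.copy pass (can_type pass_tupleK).

Notation labs w := [seq lab p | p <- w].

(** Both sums reduce to the support of [T]. This serves to compare words with different sets of
    labels. *)
Lemma eq_big_support (V : zmodType) (T : nat -> V) (s1 s2 : seq nat) :
  uniq s1 -> uniq s2 ->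
  (forall x, x \notin s1 -> T x = 0) -> (forall x, x \notin s2 -> T x = 0) ->
  \sum_(x <- s1) T x = \sum_(x <- s2) T x.
Proof.
move=> us1 us2 T1 T2.
have supp s : \sum_(x <- s) T x = \sum_(x <- [seq x <- s | T x != 0]) T x.
  rewrite big_filter [RHS]big_mkcond; apply: eq_bigr => x _.
  by case: eqP.
rewrite (supp s1) (supp s2); apply: perm_big; apply: uniq_perm.
- exact: filter_uniq.
- exact: filter_uniq.
move=> x; rewrite !mem_filter; case: eqP => //= Tx.
by apply/idP/idP => _; apply: contraT => /T1 + || apply: contraT => /T2.
Qed.

(** Exchanging the sums over labels and over passes lets the two passes of each double point
    cancel. *)
Lemma sum_by_label (F : pass -> int) (w : code) :
  (forall x, \sum_(p <- w | lab p == x) F p = 0) -> \sum_(p <- w) F p = 0.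
Proof.
move=> F0; transitivity (\sum_(x <- undup (labs w)) \sum_(p <- w | lab p == x) F p);
  last by rewrite big1.
under [RHS]eq_bigr do rewrite big_mkcond.
rewrite exchange_big /= big_seq [RHS]big_seq; apply: eq_bigr => p wp.
rewrite (bigD1_seq (lab p)) ?undup_uniq ?mem_undup ?map_f //= eqxx.
by rewrite big1 ?addr0 // => x; rewrite eq_sym => /negbTE->.
Qed.

(** * Well-formed words and multiplicities of labels *)

(** Cutting the word at the two passes through x leaves pieces that do not meet x, so that
    computations at x become explicit. *)
Variant paired (x : nat) (w : code) : Prop :=
| Absent of x \notin labs w
| Paired u p v q z of w = u ++ p :: v ++ q :: z
    & lab p = x & lab q = x & frame q = ~~ frame p & kind q = Defs.opp (kind p)
    & x \notin labs u & x \notin labs v & x \notin labs z.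

Lemma big_label_notin (F : pass -> int) x (w : code) :
  x \notin labs w -> \sum_(p <- w | lab p == x) F p = 0.
Proof.
move=> xw; rewrite big_seq_cond big_pred0 // => p.
by apply: contraNF xw => /andP[wp /eqP<-]; apply: map_f.
Qed.

Lemma mem_pair x u p v q z (r : pass) :
  x \notin labs u -> x \notin labs v -> x \notin labs z ->
  r \in u ++ p :: v ++ q :: z -> lab r = x -> r = p \/ r = q.
Proof.
move=> xu xv xz + rx; rewrite !(mem_cat, inE).
move=> /orP[ru|/orP[/eqP->|/orP[rv|/orP[/eqP->|rz]]]]; [|by left| |by right|].
- by rewrite -rx map_f in xu.
- by rewrite -rx map_f in xv.
- by rewrite -rx map_f in xz.
Qed.

Lemma split_filter (a : pred pass) (w s : code) p :
  [seq q <- w | a q] = p :: s ->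
  exists u v, [/\ w = u ++ p :: v, a p, ~~ has a u & [seq q <- v | a q] = s].
Proof.
elim: w => //= q w IH; case: ifP => aq; first by case=> <- <-; exists [::], w.
by move=> /IH[u [v [-> ap au <-]]]; exists (q :: u), v; rewrite /= aq.
Qed.

Lemma notin_labs x w : (x \notin labs w) = ~~ has (fun p => lab p == x) w.
Proof. by rewrite -has_pred1 has_map. Qed.

Lemma well_formed_paired w x : well_formed w -> paired x w.
Proof.
move=> /allP wfw; case: (boolP (x \in labs w)) => [/wfw|]; last exact: Absent.
case E: [seq p <- w | lab p == x] => [|p [|q []]] // /andP[fpq kpq].
have [u [v [-> /eqP px ux]]] := split_filter E.
move=> /split_filter[v' [z [-> /eqP qx vx zx]]].
apply: (@Paired x _ u p v' q z) => //.
- by case: (frame p) (frame q) fpq => [] [].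
- by case: (kind p) (kind q) kpq => [] [].
- by rewrite notin_labs.
- by rewrite notin_labs.
- by rewrite notin_labs has_filter zx.
Qed.

Definition mult (x : nat) (w : code) : nat := count (fun p => lab p == x) w.

Lemma mult_cat x u v : mult x (u ++ v) = (mult x u + mult x v)%N.
Proof. exact: count_cat. Qed.

Lemma mult_eq0 x w : (mult x w == 0%N) = (x \notin labs w).
Proof. by rewrite notin_labs has_count -leqNgt leqn0. Qed.

Lemma mult_notin x w : x \notin labs w -> mult x w = 0%N.
Proof. by rewrite -mult_eq0 => /eqP. Qed.

Lemma mult0P x w : mult x w = 0%N -> x \notin labs w.
Proof. by rewrite -mult_eq0 => ->. Qed.

(** A source of freshness: the labels written out by a move already reach this bound, so linear
    arithmetic shows that they occur nowhere else. *)
Lemma mult_well_formed w x : well_formed w -> (mult x w <= 2)%N.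
Proof.
move=> /(@well_formed_paired _ x)[/mult_notin-> //|u p v q z -> px qx _ _].
move=> /mult_notin ux /mult_notin vx /mult_notin zx.
by rewrite mult_cat /= mult_cat /= ux vx zx px qx eqxx.
Qed.

(** * Flow along the word, index, and weighted index polynomial *)

Definition flow_sign (p : pass) : int :=
  if is_classical (kind p) then if frame p then 1 else - 1 else 0.

Definition flow (w : code) : int := \sum_(p <- w) flow_sign p.

(* The flow of the part of [w] lying between the two passes through x, [b]
   telling whether the reading of [w] starts inside that part. *)
Fixpoint arc_flow (x : nat) (b : bool) (w : code) : int :=
  if w is p :: w' then
    if lab p == x then arc_flow x (~~ b) w'
    else (if b then flow_sign p else 0) + arc_flow x b w'
  else 0.

(* Exactly one of the two passes through x has a positive frame. *)
Definition weight (f : role -> int) (x : nat) (w : code) : int :=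
  \sum_(p <- w | (lab p == x) && frame p) f (kind p).

Definition index_term f x (w : code) : {poly int} :=
  weight f x w *: 'X^(absz (arc_flow x false w)).

(** The weight [f] is a parameter so that one invariance proof serves both p_t and the value on
    knots with one double point. *)
Definition index_poly f (w : code) : {poly int} :=
  \sum_(x <- undup (labs w)) index_term f x w.

Lemma flow_cat u v : flow (u ++ v) = flow u + flow v.
Proof. exact: big_cat. Qed.

Lemma flow_rev u : flow (rev u) = flow u.
Proof. by apply: perm_big; rewrite perm_rev. Qed.

Lemma arc_flow_cat x b u v :
  arc_flow x b (u ++ v) =
  arc_flow x b u + arc_flow x (b (+) odd (mult x u)) v.
Proof.
elim: u b => [|p u IH] b /=; first by rewrite add0r addbF.
case: ifP => _; rewrite IH ?addrA // oddD.
by case: b; case: odd.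
Qed.

Lemma arc_flow_notin x b u :
  x \notin labs u -> arc_flow x b u = if b then flow u else 0.
Proof.
rewrite /flow; elim: u => [|p u IH] /=; first by rewrite big_nil if_same.
rewrite inE negb_or eq_sym => /andP[/negbTE-> /IH->]; rewrite big_cons.
by case: (b).
Qed.

Lemma arc_flow_rev x b u :
  x \notin labs u -> arc_flow x b (rev u) = arc_flow x b u.
Proof.
by move=> xu; rewrite !arc_flow_notin ?map_rev ?mem_rev ?flow_rev.
Qed.

Lemma flowE x u :
  flow u = \sum_(p <- u | lab p == x) flow_sign p
           + arc_flow x true u + arc_flow x false u.
Proof.
rewrite /flow; elim: u => [|p u IH] /=; first by rewrite !big_nil.
by rewrite !big_cons IH; case: eqP => _ /=; lia.
Qed.

Lemma weight_cat f x u v : weight f x (u ++ v) = weight f x u + weight f x v.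
Proof. exact: big_cat. Qed.

Lemma weight_perm f x u v : perm_eq u v -> weight f x u = weight f x v.
Proof. exact: perm_big. Qed.

Lemma weight_notin f x w : x \notin labs w -> weight f x w = 0.
Proof.
move=> xw; rewrite /weight big_seq_cond big_pred0 // => p.
apply: contraNF xw => /andP[wp /andP[/eqP<- _]]; exact: map_f.
Qed.

Lemma index_term_notin f x w : x \notin labs w -> index_term f x w = 0.
Proof. by move=> xw; rewrite /index_term weight_notin ?scale0r. Qed.

(** The sum may range over any list covering the support, for instance the labels of another
    word. *)
Lemma index_polyE f w s :
  uniq s -> (forall x, x \notin s -> index_term f x w = 0) ->
  index_poly f w = \sum_(x <- s) index_term f x w.
Proof.
move=> us sP; apply: eq_big_support => //; first exact: undup_uniq.
by move=> x; rewrite mem_undup => /index_term_notin.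
Qed.

Lemma eq_index_poly f w w' :
  (forall x, index_term f x w = index_term f x w') ->
  index_poly f w = index_poly f w'.
Proof.
move=> E; rewrite (@index_polyE _ _ (undup (labs w'))) ?undup_uniq //.
  by apply: eq_bigr => x _; apply: E.
by move=> x; rewrite mem_undup E => /index_term_notin.
Qed.

(** Used for R1 and R2, where a and b are the two crossings that the move removes. *)
Lemma index_poly_cancel f w w' a b :
  a != b -> a \notin labs w' -> b \notin labs w' ->
  index_term f a w + index_term f b w = 0 ->
  (forall x, x != a -> x != b -> index_term f x w = index_term f x w') ->
  index_poly f w = index_poly f w'.
Proof.
move=> ab aw' bw' ab0 E.
have u : uniq [:: a, b & undup (labs w')].
  by rewrite /= !inE !mem_undup negb_or ab aw' bw' undup_uniq.
rewrite (@index_polyE _ w _ u); last first.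
  move=> x; rewrite !inE !negb_or mem_undup => /and3P[xa xb xw'].
  by rewrite E // index_term_notin.
rewrite !big_cons addrA ab0 add0r big_seq [RHS]big_seq.
apply: eq_bigr => x; rewrite mem_undup => xw'; apply: E.
  by apply: contraNneq aw' => <-.
by apply: contraNneq bw' => <-.
Qed.

(** * Independence of the base point *)

Lemma sum_pair_flow w x :
  well_formed w -> \sum_(p <- w | lab p == x) flow_sign p = 0.
Proof.
move=> /(@well_formed_paired _ x)[xw|u p v q z -> px qx fq kq ux vx zx].
  exact: big_label_notin.
rewrite big_cat big_cons px eqxx big_cat big_cons qx eqxx.
rewrite !big_label_notin //=.
by rewrite /flow_sign fq kq; case: (kind p); case: (frame p).
Qed.

Lemma flow_well_formed w : well_formed w -> flow w = 0.
Proof. by move=> wfw; apply: sum_by_label => x; apply: sum_pair_flow. Qed.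

(** If the cut separates the two passes of x, rotation replaces the arc between them by the
    complementary arc. The total flow and the flow of the passes at x both vanish, so the two arcs
    have opposite flows, and [absz] forgets the sign. *)
Lemma index_poly_rot f k w :
  well_formed w -> index_poly f (rot k w) = index_poly f w.
Proof.
move=> wfw; apply: eq_index_poly => x; rewrite /index_term.
rewrite (weight_perm _ _ (_ : perm_eq (rot k w) w)) ?perm_rot //.
case: (well_formed_paired x wfw) => [xw|].
  by rewrite weight_notin ?scale0r.
move=> u p v q z Ew px qx _ _ ux vx zx.
have even_x : odd (mult x w) = false.
  by rewrite Ew mult_cat /= mult_cat /= px qx eqxx !mult_notin.
have := flow_well_formed wfw; have := sum_pair_flow x wfw.
move: even_x; rewrite /rot -{1 2 3 8}(cat_take_drop k w).
move: (take k w) (drop k w) => s t {Ew}.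
rewrite mult_cat oddD big_cat /=; move=> ev.
rewrite flow_cat !(flowE x) => E1 E2; congr (_ *: 'X^ _).
rewrite !arc_flow_cat /=.
have {ev} -> : odd (mult x t) = odd (mult x s).
  by case: (odd _) (odd _) ev => [] [].
move: E1 E2; set ps := \sum_(i <- s | _) _; set pt := \sum_(i <- t | _) _.
by case: (odd _); lia.
Qed.

(** * The moves on kinks and bigons *)

Lemma is_classical_opp r : is_classical (Defs.opp r) = is_classical r.
Proof. by case: r. Qed.

Lemma is_double_opp r : is_double (Defs.opp r) = is_double r.
Proof. by case: r. Qed.

Lemma perm_along d w : perm_eq (along d w) w.
Proof. by case: d => //=; rewrite perm_rev. Qed.

Lemma mult_along x d w :
  mult x (along d w) = mult x w.
Proof. by apply/permP/perm_along. Qed.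

Lemma mult_rev x w : mult x (rev w) = mult x w.
Proof. by rewrite /mult count_rev. Qed.

Lemma arc_flow_along x b d w :
  x \notin labs w -> arc_flow x b (along d w) = arc_flow x b w.
Proof. by move=> xw; case: d => //; apply: arc_flow_rev. Qed.

Lemma weight_along f x d w : weight f x (along d w) = weight f x w.
Proof. exact/weight_perm/perm_along. Qed.

Lemma weight_cons f x p w :
  weight f x (p :: w) =
  (if (lab p == x) && frame p then f (kind p) else 0) + weight f x w.
Proof. by rewrite /weight big_cons; case: ifP; rewrite ?add0r. Qed.

Lemma weight_nil f x : weight f x [::] = 0.
Proof. exact: big_nil. Qed.

Section Signs.

Variable f : role -> int.
Hypotheses (fU : f Under = - f Over) (fV : f Virtual = 0).

(** By [fU] the weight of a classical crossing is [f Over] times its sign, so the two kinks have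
    opposite weights; each encloses an empty arc, so both exponents are 0. *)
Lemma index_poly_framed_R1 a b e1 e2 r1 r2 w :
  well_formed (kink a e1 r1 ++ kink b e2 r2 ++ w) ->
  is_classical r1 -> is_classical r2 ->
  pass_sign e1 r1 != pass_sign e2 r2 ->
  index_poly f (kink a e1 r1 ++ kink b e2 r2 ++ w) = index_poly f w.
Proof.
move=> wfw c1 c2 e12.
have := mult_well_formed a wfw; have := mult_well_formed b wfw.
rewrite /= !eqxx /= (eq_sym b a); case: eqP => [|/eqP ab] //=.
rewrite !add1n !ltnS !leqn0 => /eqP/mult0P bw /eqP/mult0P aw.
have ba : b != a by rewrite eq_sym.
apply: (index_poly_cancel ab aw bw) => [|x xa xb].
  rewrite /index_term /= !eqxx (negbTE ab) (negbTE ba) /= !arc_flow_notin //=.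
  rewrite !weight_cons /= !eqxx (negbTE ab) (negbTE ba) /= !weight_notin //.
  rewrite -scalerDl [X in X *: _](_ : _ = 0) ?scale0r //.
  rewrite /pass_sign in e12; case: (r1) c1 e12 => // _; case: (r2) c2 => // _;
    by case: (e1); case: (e2) => //= _; rewrite fU; lia.
rewrite /index_term !weight_cons /= ![_ == x]eq_sym (negbTE xa) (negbTE xb) /=.
by rewrite !add0r.
Qed.

Lemma index_poly_virtual_R1 a e w :
  well_formed (kink a e Virtual ++ w) ->
  index_poly f (kink a e Virtual ++ w) = index_poly f w.
Proof.
move=> wfw; have := mult_well_formed a wfw.
rewrite /= !eqxx !add1n !ltnS !leqn0 => /eqP/mult0P aw.
apply: eq_index_poly => x; rewrite /index_term !weight_cons /=.
have [<-|ax] := eqVneq a x; last by rewrite !add0r.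
by rewrite fV !if_same !add0r weight_notin.
Qed.

Lemma index_poly_R2 a b e d r u v :
  well_formed (bigon1 a b e r ++ u ++ along d (bigon2 a b e r) ++ v) ->
  is_classical r || is_virtual r ->
  index_poly f (bigon1 a b e r ++ u ++ along d (bigon2 a b e r) ++ v)
  = index_poly f (u ++ v).
Proof.
move=> wfw cr.
have fr : f r + f (Defs.opp r) = 0.
  by case: (r) cr; rewrite //= ?fU ?fV ?addr0 ?subrr ?addNr.
have ca := mult_well_formed a wfw; have cb := mult_well_formed b wfw.
have ab : a != b.
  apply: contraTneq ca => ->.
  by rewrite !mult_cat mult_along /= !eqxx; lia.
have ba : b != a by rewrite eq_sym.
rewrite !mult_cat !mult_along /= !eqxx (negbTE ab) (negbTE ba) in ca cb.
have /mult0P au : mult a u = 0%N by lia.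
have /mult0P av : mult a v = 0%N by lia.
have /mult0P bu : mult b u = 0%N by lia.
have /mult0P bv : mult b v = 0%N by lia.
apply: (index_poly_cancel ab); try by rewrite map_cat mem_cat; apply/norP.
  rewrite /index_term.
  set i := absz (arc_flow a _ _); set j := absz (arc_flow b _ _).
  (* If the branches run in parallel, the arc of a meets one pass of b, the arc of b one pass of a,
     and both have frame [~~ e]. Otherwise the arc of a meets both passes of b, which cancel, and
     the arc of b meets no pass of a. *)
  have -> : i = j.
    rewrite /i /j {i j} !arc_flow_cat !mult_along !(mult_notin au) !(mult_notin bu).
    rewrite !(arc_flow_notin _ au) !(arc_flow_notin _ av).
    rewrite !(arc_flow_notin _ bu) !(arc_flow_notin _ bv) /=.
    rewrite !eqxx (negbTE ab) (negbTE ba) /= /flow_sign /=.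
    case: (d); rewrite /along /rev /= ?eqxx ?(negbTE ab) ?(negbTE ba) /=;
      rewrite /flow_sign /= ?is_classical_opp; case: (e); case: is_classical => /=; lia.
  rewrite -scalerDl [X in X *: _](_ : _ = 0) ?scale0r //.
  rewrite !weight_cat !weight_along !(weight_notin _ au).
  rewrite !(weight_notin _ av) !(weight_notin _ bu) !(weight_notin _ bv).
  rewrite !weight_cons !weight_nil /= !eqxx (negbTE ab) (negbTE ba) /=.
  by case: (e); rewrite /=; lia.
move=> x; rewrite ![x == _]eq_sym => ax bx; rewrite /index_term.
have x1 : x \notin labs (bigon1 a b e r).
  by rewrite !inE !negb_or /= ![x == _]eq_sym ax.
have x2 : x \notin labs (bigon2 a b e r).
  by rewrite !inE !negb_or /= ![x == _]eq_sym ax.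
rewrite !weight_cat weight_along (weight_notin _ x1) (weight_notin _ x2) !add0r.
rewrite !arc_flow_cat arc_flow_along // mult_along.
rewrite (arc_flow_notin _ x1) (arc_flow_notin _ x2).
rewrite (mult_notin x1) (mult_notin x2) /= !addbF add0r.
(* The first branch is read before any pass of x, hence outside its arc. The second may lie inside,
   but its two passes have opposite frames. *)
suff -> : flow (bigon2 a b e r) = 0 by rewrite if_same add0r.
rewrite /flow !big_cons big_nil /flow_sign /= is_classical_opp.
by case: (e); case: is_classical.
Qed.

End Signs.

(** * The triangle moves *)

Section TriangleMove.

Variables (a b c : nat) (e d1 d2 d3 : bool) (r12 r13 r23 : role).
Variables (u v w : code).
Let t1 := tri1 a b e d1 d2 d3 r12 r13.
Let t2 := tri2 a c e d1 d2 d3 r12 r23.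
Let t3 := tri3 b c e d1 d2 d3 r13 r23.
Let before := t1 ++ u ++ t2 ++ v ++ t3 ++ w.
Let after := rev t1 ++ u ++ rev t2 ++ v ++ rev t3 ++ w.

Lemma perm_triangle : perm_eq before after.
Proof.
have pr (t : code) : perm_eq t (rev t) by rewrite perm_sym perm_rev.
rewrite /before /after; apply: (perm_cat (pr _)); rewrite perm_cat2l; apply: (perm_cat (pr _)).
by rewrite perm_cat2l; apply: (perm_cat (pr _)).
Qed.

Hypothesis wf_before : well_formed before.

(** Each corner is written twice in the three branches, and two equal corners would exceed
    multiplicity 2. *)
Lemma triangle_labels :
  [/\ a != b, a != c & b != c] /\
  forall x, x \in [:: a; b; c] ->
    [/\ x \notin labs u, x \notin labs v & x \notin labs w].
Proof.
have cnt x := mult_well_formed x wf_before.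
have m1 x : mult x t1 = ((a == x) + (b == x))%N by rewrite mult_along /= addn0.
have m2 x : mult x t2 = ((a == x) + (c == x))%N by rewrite mult_along /= addn0.
have m3 x : mult x t3 = ((b == x) + (c == x))%N by rewrite mult_along /= addn0.
have ab : a != b.
  by apply: contraTneq (cnt a) => E; rewrite !mult_cat m1 m2 m3 -E eqxx; lia.
have ac : a != c.
  by apply: contraTneq (cnt a) => E; rewrite !mult_cat m1 m2 m3 -E eqxx; lia.
have bc : b != c.
  by apply: contraTneq (cnt b) => E; rewrite !mult_cat m1 m2 m3 -E eqxx; lia.
split=> // x xabc; have := cnt x; rewrite !mult_cat m1 m2 m3 => cx.
have : (2 <= (a == x) + (b == x) + ((a == x) + (c == x)) +
            ((b == x) + (c == x)))%N.
  by move: xabc; rewrite !inE => /or3P[] /eqP->; rewrite eqxx; lia.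
by split; apply: mult0P; lia.
Qed.

(** Each branch lies wholly inside or wholly outside the arc of x, so the order of its two passes is
    irrelevant. *)
Lemma index_term_other f x :
  x \notin [:: a; b; c] -> index_term f x before = index_term f x after.
Proof.
rewrite !inE !negb_or ![x == _]eq_sym => /and3P[ax bx cx].
have x1 : x \notin labs t1.
  by apply: mult0P; rewrite mult_along /= !(negbTE ax, negbTE bx).
have x2 : x \notin labs t2.
  by apply: mult0P; rewrite mult_along /= !(negbTE ax, negbTE cx).
have x3 : x \notin labs t3.
  by apply: mult0P; rewrite mult_along /= !(negbTE cx, negbTE bx).
rewrite /index_term (weight_perm _ _ perm_triangle) !arc_flow_cat.
by rewrite !arc_flow_rev // !mult_rev.
Qed.

(** When branches 1 and 2 run alike, the arc of a trades a pass of b for a pass of c with the same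
    frame. When they run oppositely, it meets both on one side of the move, with opposite frames,
    and neither on the other. The hypothesis makes these passes count alike; branch 3 is read after
    both passes of a. *)
Lemma arc_flow12 :
  is_classical r13 = is_classical r23 ->
  arc_flow a false before = arc_flow a false after.
Proof.
move=> k; have [[ab ac bc]] := triangle_labels.
move=> /(_ a); rewrite !inE eqxx => /(_ isT)[au av aw].
rewrite !arc_flow_cat !mult_rev.
rewrite !(arc_flow_notin _ au) !(arc_flow_notin _ av) !(arc_flow_notin _ aw).
rewrite !(mult_notin au) !(mult_notin av) /t1 /t2 /t3 /tri1 /tri2 /tri3.
by case: (d1); case: (d2); case: (d3);
  rewrite /along /rev /mult /= ?(eq_sym b a) ?(eq_sym c a) ?eqxx ?(negbTE ab) ?(negbTE ac) ?(negbTE bc) /=;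
  rewrite /flow_sign /= ?is_classical_opp ?k; case: (e); case: is_classical => /=;
  lia.
Qed.

Lemma arc_flow13 :
  is_classical r12 = is_classical r23 ->
  arc_flow b false before = arc_flow b false after.
Proof.
move=> k; have [[ab ac bc]] := triangle_labels.
move=> /(_ b); rewrite !inE eqxx orbT => /(_ isT)[bu bv bw].
rewrite !arc_flow_cat !mult_rev.
rewrite !(arc_flow_notin _ bu) !(arc_flow_notin _ bv) !(arc_flow_notin _ bw).
rewrite !(mult_notin bu) !(mult_notin bv) /t1 /t2 /t3 /tri1 /tri2 /tri3.
by case: (d1); case: (d2); case: (d3);
  rewrite /along /rev /mult /= ?(eq_sym c b) ?eqxx ?(negbTE ab) ?(negbTE ac) ?(negbTE bc) /=;
  rewrite /flow_sign /= ?is_classical_opp ?k; case: (e); case: is_classical => /=;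
  lia.
Qed.

Lemma arc_flow23 :
  is_classical r12 = is_classical r13 ->
  arc_flow c false before = arc_flow c false after.
Proof.
move=> k; have [[ab ac bc]] := triangle_labels.
move=> /(_ c); rewrite !inE eqxx !orbT => /(_ isT)[cu cv cw].
rewrite !arc_flow_cat !mult_rev.
rewrite !(arc_flow_notin _ cu) !(arc_flow_notin _ cv) !(arc_flow_notin _ cw).
rewrite !(mult_notin cu) !(mult_notin cv) /t1 /t2 /t3 /tri1 /tri2 /tri3.
by case: (d1); case: (d2); case: (d3);
  rewrite /along /rev /mult /= ?eqxx ?(negbTE ab) ?(negbTE ac) ?(negbTE bc) /=;
  rewrite /flow_sign /= ?is_classical_opp ?k; case: (e); case: is_classical => /=;
  lia.
Qed.

Variable f : role -> int.

(** A corner with such a role has weight 0, so its index is allowed to change. *)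
Let unseen r := (f r == 0) && (f (Defs.opp r) == 0).

(** There is one condition per corner: either its term is zero on both sides, or the flow counts
    both of the other corners or neither. *)
Lemma index_poly_triangle :
  unseen r12 || (is_classical r13 == is_classical r23) ->
  unseen r13 || (is_classical r12 == is_classical r23) ->
  unseen r23 || (is_classical r12 == is_classical r13) ->
  index_poly f before = index_poly f after.
Proof.
have [[ab ac bc] nin] := triangle_labels.
have unseen_term x r : unseen r -> x \in [:: a; b; c] ->
    {in t1 ++ t2 ++ t3, forall p, lab p = x -> kind p = r \/ kind p = Defs.opp r} ->
  index_term f x before = index_term f x after.
  move=> /andP[/eqP fr /eqP fr'] /nin[xu xv xw] kp.
  rewrite /index_term -(weight_perm _ _ perm_triangle).
  suff -> : weight f x before = 0 by rewrite !scale0r.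
  rewrite !weight_cat !(weight_notin _ xu) !(weight_notin _ xv).
  rewrite (weight_notin _ xw) addr0 !add0r -!weight_cat /weight.
  rewrite big_seq_cond big1 // => p /andP[pt /andP[/eqP px _]].
  by case: (kp p pt px) => ->.
move=> k12 k13 k23; apply: eq_index_poly => x.
case: (boolP (x \in [:: a; b; c])) => [|/index_term_other//].
rewrite !inE => /or3P[] /eqP->.
- case/orP: k12 => [un|/eqP k]; last first.
    by rewrite /index_term (weight_perm _ _ perm_triangle) arc_flow12.
  apply: (unseen_term a r12) => //; rewrite ?inE ?eqxx ?orbT //.
  move=> p; rewrite !mem_cat !(perm_mem (perm_along _ _)) !inE.
  by move=> /orP[|/orP[]] /orP[] /eqP->; auto; rewrite /= => E;
    move: ab ac bc; rewrite E eqxx.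
- case/orP: k13 => [un|/eqP k]; last first.
    by rewrite /index_term (weight_perm _ _ perm_triangle) arc_flow13.
  apply: (unseen_term b r13) => //; rewrite ?inE ?eqxx ?orbT //.
  move=> p; rewrite !mem_cat !(perm_mem (perm_along _ _)) !inE.
  by move=> /orP[|/orP[]] /orP[] /eqP->; auto; rewrite /= => E;
    move: ab ac bc; rewrite E eqxx.
- case/orP: k23 => [un|/eqP k]; last first.
    by rewrite /index_term (weight_perm _ _ perm_triangle) arc_flow23.
  apply: (unseen_term c r23) => //; rewrite ?inE ?eqxx ?orbT //.
  move=> p; rewrite !mem_cat !(perm_mem (perm_along _ _)) !inE.
  by move=> /orP[|/orP[]] /orP[] /eqP->; auto; rewrite /= => E;
    move: ab ac bc; rewrite E eqxx.
Qed.

End TriangleMove.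

(** * Invariance under all framed moves *)

Lemma index_poly_relabel f g w :
  injective g -> index_poly f [seq relabel g p | p <- w] = index_poly f w.
Proof.
move=> gI; rewrite /index_poly.
have -> : labs [seq relabel g p | p <- w] = map g (labs w).
  by rewrite -!map_comp.
rewrite (undup_map_inj gI) big_map; apply: eq_bigr => x _.
rewrite /index_term /weight big_map /=.
under eq_bigl do rewrite (inj_eq gI).
congr (_ *: 'X^(absz _)); elim: w false => //= p w IH b.
by rewrite (inj_eq gI) !IH.
Qed.

Lemma index_poly_framed f w w' :
  f Under = - f Over -> f Virtual = 0 ->
  framed_move w w' -> well_formed w -> well_formed w' ->
  index_poly f w = index_poly f w'.
Proof.
move=> fU fV; case=> {w w'}.
- by move=> k w wfw _; rewrite index_poly_rot.
- by move=> g w gI _ _; rewrite index_poly_relabel.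
- by move=> a b e1 e2 r1 r2 w c1 c2 s12 wfw _; apply: index_poly_framed_R1.
- by move=> a e w wfw _; apply: index_poly_virtual_R1.
- by move=> a b e d r u v cr wfw _; apply: index_poly_R2.
move=> a b c e d1 d2 d3 r12 r13 r23 u v w roles /= wfw _.
(* In a mixed move the only corner carrying weight is the classical one, and the other two are both
   virtual. *)
by apply: index_poly_triangle => //;
  case: roles => [h1 h2 h3 _||r cr|r cr|r cr] /=; rewrite ?fV ?oppr0 ?eqxx ?cr //=;
  rewrite /above; do 3?case: ifP; rewrite /= ?orbT.
Qed.

(** * Comparison of p_t with the index polynomial *)

Definition sign_weight (r : role) : int :=
  match r with Over => 1 | Under => -1 | _ => 0 end.

(** Selects the double points: if x is the only one, the index polynomial is t^|i(x)|. *)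
Definition double_weight (r : role) : int := (is_double r)%:R.

Lemma mem_crossings (P : pred role) w p : p \in w -> P (kind p) -> lab p \in crossings P w.
Proof.
move=> wp Pp; rewrite mem_undup.
by apply/mapP; exists p; rewrite ?mem_filter ?Pp.
Qed.

Lemma weight_unseen f x w (P : pred role) :
  (forall r, ~~ P r -> f r = 0) -> x \notin crossings P w -> weight f x w = 0.
Proof.
move=> fP xw; rewrite /weight big_seq_cond big1 // => p /and3P[wp /eqP px _].
by apply: fP; apply: contra xw => /(mem_crossings wp); rewrite px.
Qed.

Lemma smoothingE x u p v q z :
  lab p = x -> lab q = x -> x \notin labs u -> x \notin labs v ->
  smoothing x (u ++ p :: v ++ q :: z) = (v, z ++ u).
Proof.
move=> px qx; rewrite !notin_labs => xu xv; rewrite /smoothing.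
rewrite find_cat (negbTE xu) /= px eqxx addn0 rot_size_cat /= -catA.
rewrite find_cat (negbTE xv) /= qx eqxx addn0 take_size_cat //.
by rewrite -cat_rcons drop_size_cat ?size_rcons.
Qed.

Lemma intersection_indexE x w :
  well_formed w -> x \in labs w -> intersection_index x w = arc_flow x false w.
Proof.
move=> wfw xw; case: (well_formed_paired x wfw) => [|u p v q z Ew px qx _ _].
  by rewrite xw.
move=> xu xv xz.
have -> : arc_flow x false w = flow v.
  rewrite Ew arc_flow_cat mult_notin //= px eqxx arc_flow_cat mult_notin //=.
  by rewrite qx eqxx !arc_flow_notin // !add0r addr0.
rewrite /intersection_index Ew smoothingE // /flow.
(* The flow of the arc splits into the crossings shared with the other component and the
   self-crossings of the arc. *)
rewrite [RHS](bigID (fun p => lab p \in labs (z ++ u))) /=.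
rewrite [X in _ = _ + X](_ : _ = 0) ?addr0.
  rewrite big_mkcondl [RHS]big_mkcond [LHS]big_mkcond; apply: eq_bigr => r _.
  by rewrite /flow_sign; case: is_classical; case: ifP.
rewrite -big_filter; apply: sum_by_label => y; rewrite big_filter_cond.
case yB: (y \in labs (z ++ u)).
  by rewrite big_pred0 // => r; apply/andP => -[rB /eqP ry]; rewrite ry yB in rB.
have [->|yx] := eqVneq y x.
  rewrite big_seq_cond big_pred0 // => r; apply/and3P => -[rv _ /eqP rx].
  by rewrite -rx map_f in xv.
rewrite (eq_bigl (fun r => lab r == y)); last first.
  by move=> r; case: eqP => [->|]; rewrite ?yB ?andbF.
(* Since y differs from x and does not occur in [z ++ u], all its passes in [w] lie in [v], where
   they cancel. *)
rewrite -[RHS](sum_pair_flow y wfw) Ew big_cat big_cons big_cat big_cons /=.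
rewrite px qx eq_sym (negbTE yx).
move: yB; rewrite map_cat mem_cat => /negbT; rewrite negb_or => /andP[yz yu].
by rewrite (big_label_notin _ yz) (big_label_notin _ yu) add0r addr0.
Qed.

Lemma crossing_signE x w :
  well_formed w -> x \in crossings is_classical w ->
  crossing_sign x w = weight sign_weight x w.
Proof.
move=> wfw xw; case: (well_formed_paired x wfw) => [|u p v q z Ew px qx fq kq].
  move: xw; rewrite mem_undup => /mapP[r]; rewrite mem_filter => /andP[_ rw] ->.
  by rewrite map_f.
move=> xu xv xz; have cp : is_classical (kind p).
  move: xw; rewrite mem_undup => /mapP[r]; rewrite mem_filter Ew => /andP[cr].
  move=> rw /esym/(mem_pair xu xv xz rw)[<-//|rq].
  by rewrite rq kq is_classical_opp in cr.
have no s : x \notin labs s ->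
    has (fun p => (lab p == x) && is_over (kind p) && frame p) s = false.
  move=> xs; apply/hasPn => r rs; apply: contra xs => /andP[/andP[/eqP<- _] _].
  exact: map_f.
rewrite /crossing_sign Ew has_cat /= has_cat /= !no // px qx eqxx fq kq.
rewrite weight_cat weight_cons weight_cat weight_cons !(weight_notin _ _) //.
rewrite px qx eqxx fq kq /= orbF.
by case: (kind p) cp => // _; case: (frame p).
Qed.

Lemma p_tE (K : diagram) : p_t K = index_poly sign_weight (word_of K).
Proof.
rewrite /p_t /word_of; case: (val K) => w /= /andP[wfw _].
rewrite (@index_polyE _ _ (crossings is_classical w)) ?undup_uniq //; last first.
  move=> x /weight_unseen xw; rewrite /index_term xw ?scale0r //.
  by case.
rewrite big_seq [RHS]big_seq; apply: eq_bigr => x xw.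
rewrite crossing_signE // intersection_indexE //.
move: xw; rewrite mem_undup => /mapP[r]; rewrite mem_filter => /andP[_ rw] ->.
exact: map_f.
Qed.

(** * Double points under the moves, and rigid vertex moves *)

(** Counting passes instead of distinct labels gives a quantity that is additive and invariant under
    permutation. *)
Definition double_passes (w : code) : nat := count (fun p => is_double (kind p)) w.

Lemma double_passesE w : well_formed w -> double_passes w = (n_double w).*2.
Proof.
move=> wfw; rewrite /double_passes -size_filter /n_double /crossings.
rewrite -(size_map lab); set s := map lab _.
have two x : x \in undup s -> count_mem x s = 2%N.
  rewrite mem_undup => /mapP[r]; rewrite mem_filter => /andP[dr rw] xr.
  rewrite count_map count_filter /=.
  case: (well_formed_paired x wfw) => [|u p v q z Ew px qx _ kq xu xv xz].
    by rewrite xr map_f.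
  have no t : x \notin labs t ->
      count (predI (preim lab (pred1 x)) (fun p => is_double (kind p))) t = 0%N.
    move=> xt; apply/eqP; rewrite -leqn0 -(mult_notin xt); apply: sub_count.
    by move=> y /andP[].
  have dp : is_double (kind p).
    rewrite Ew in rw; case: (mem_pair xu xv xz rw (esym xr)) => [<-//|rq].
    by rewrite rq kq is_double_opp in dr.
  rewrite Ew count_cat /= count_cat /= !no // px qx eqxx kq dp.
  by case: (kind p) dp.
rewrite -(perm_size (perm_count_undup s)) size_flatten /shape -map_comp.
rewrite -muln2; elim: (undup s) two => //= x t IH two.
rewrite size_nseq two ?mem_head // IH // => y yt.
by apply: two; rewrite inE yt orbT.
Qed.

Lemma double_passes_cat u v :
  double_passes (u ++ v) = (double_passes u + double_passes v)%N.
Proof. exact: count_cat. Qed.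

Lemma double_passes_perm u v : perm_eq u v -> double_passes u = double_passes v.
Proof. by move/permP => E; apply: E. Qed.

Lemma double_passes_rev w : double_passes (rev w) = double_passes w.
Proof. exact: count_rev. Qed.

Lemma double_passes_along d w : double_passes (along d w) = double_passes w.
Proof. exact/double_passes_perm/perm_along. Qed.

Lemma double_passes_framed w w' :
  framed_move w w' -> double_passes w = double_passes w'.
Proof.
case=> {w w'}.
- by move=> k w; apply: double_passes_perm; rewrite perm_sym perm_rot.
- by move=> g w _; rewrite /double_passes count_map.
- by move=> a b e1 e2 r1 r2 w c1 c2 _ /=; case: r1 c1 => //; case: r2 c2.
- by [].
- move=> a b e d r u v cr; rewrite !double_passes_cat double_passes_along /=.
  by rewrite is_double_opp; case: r cr.
move=> a b c e d1 d2 d3 r12 r13 r23 u v w _ t1 t2 t3.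
by rewrite !double_passes_cat !double_passes_rev.
Qed.

Lemma double_passes_rigid w w' :
  rigid_move w w' -> double_passes w = double_passes w'.
Proof.
case=> {w w'}.
  move=> a b c e d1 d2 d3 r12 r13 r23 u v w _ t1 t2 t3.
  by rewrite !double_passes_cat !double_passes_rev.
move=> a x e d r u v cr; rewrite !double_passes_cat !double_passes_along /=.
by rewrite is_double_opp; case: r cr.
Qed.

(** Excludes rigid moves between knots without double points, where the extension is computed from
    crossing signs. *)
Lemma double_passes_rigid_gt0 w w' : rigid_move w w' -> (0 < double_passes w)%N.
Proof.
case=> {w w'} => [a b c e d1 d2 d3 r12 r13 r23 u v w roles t1 t2 t3|].
  rewrite !double_passes_cat !double_passes_along /= {t1 t2 t3}.
  by case: roles => -[] //= _; lia.
by move=> a x e d r u v cr; rewrite double_passes_cat /=; lia.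
Qed.

(* The twist flips the frame of the crossing a, so it may change the index of
   double points other than x: uniqueness of the double point is essential. *)
Lemma index_poly_twist a x e d (r : role) u v :
  let w := [:: Pass a e r; Pass x (~~ e) Double] ++ u ++
       along d [:: Pass a (~~ e) (Defs.opp r); Pass x e Double] ++ v in
  let w' := [:: Pass x e Double; Pass a (~~ e) (Defs.opp r)] ++ u ++
       along d [:: Pass x (~~ e) Double; Pass a e r] ++ v in
  is_classical r -> well_formed w -> n_double w = 1%N ->
  index_poly double_weight w = index_poly double_weight w'.
Proof.
move=> w w' cr wfw n1; have ca := mult_well_formed a wfw.
have cx := mult_well_formed x wfw.
have xa : x != a.
  apply: contraTneq ca => E.
  by rewrite /w !mult_cat !mult_along /= E !eqxx; lia.
have ax : a != x by rewrite eq_sym.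
rewrite /w !mult_cat !mult_along /= !eqxx (negbTE xa) (negbTE ax) in ca cx.
have /mult0P xu : mult x u = 0%N by lia.
have /mult0P xv : mult x v = 0%N by lia.
have weightE y : weight double_weight y w = weight double_weight y w'.
  rewrite !weight_cat !weight_along !weight_cons !weight_nil /=.
  have da : double_weight r = 0 by case: (r) cr.
  have da' : double_weight (Defs.opp r) = 0 by case: (r) cr.
  by rewrite da da' !if_same /= !add0r !addr0; case: (e); rewrite ?andbF /=; lia.
have xw : x \in crossings is_double w.
  by apply: (@mem_crossings _ _ (Pass x (~~ e) Double)); rewrite // !inE eqxx orbT.
apply: eq_index_poly => y; rewrite /index_term -weightE.
have [->|yx] := eqVneq y x; last first.
  rewrite (weight_unseen (P := is_double)) ?scale0r //; first by case.
  move: n1 xw; rewrite /n_double; case: (crossings _ _) => [|y' [|]] // _.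
  by rewrite !inE => /eqP<-.
(* For parallel branches the arc of x trades one pass of a for the other, with frame [~~ e] both
   times. Otherwise it meets neither pass of a before the twist and both, with opposite signs, after
   it. *)
congr (_ *: 'X^(absz _)).
rewrite /w /w' !arc_flow_cat !(arc_flow_notin _ xu) !(arc_flow_notin _ xv).
rewrite !(mult_notin xu).
by case: (d); rewrite /along /rev /mult /= ?eqxx ?(negbTE ax) /=;
  rewrite /flow_sign /= ?is_classical_opp; rewrite cr; case: (e) => /=; lia.
Qed.

Lemma index_poly_rigid w w' :
  rigid_move w w' -> well_formed w -> n_double w = 1%N ->
  index_poly double_weight w = index_poly double_weight w'.
Proof.
case=> {w w'}; last by move=> a x e d r u v cr; apply: index_poly_twist.
move=> a b c e d1 d2 d3 r12 r13 r23 u v w roles /= wfw _.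
(* Only the double corner has weight, and the sliding branch makes the other two corners both
   classical or both virtual. *)
by apply: index_poly_triangle => //; case: roles => -[].
Qed.

(** * The extension to singular knots and its skein relation *)

Definition singular_index_poly (K : sdiagram) : {poly int} :=
  match n_double K with
  | 0 => index_poly sign_weight K
  | 1 => index_poly double_weight K *+ 2
  | _ => 0
  end.

Lemma well_formed_word (K : sdiagram) : well_formed K.
Proof. by case: K => w /= /andP[]. Qed.

Lemma n_double_eq (K L : sdiagram) :
  double_passes K = double_passes L -> n_double K = n_double L.
Proof.
by rewrite !double_passesE ?well_formed_word // => /double_inj.
Qed.

Lemma singular_index_poly_equiv K L :
  singular_equiv K L -> singular_index_poly K = singular_index_poly L.
Proof.
elim=> {K L} [K L|//|K L _ ->//|K L M _ -> _ ->//].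
have wK := well_formed_word K; have wL := well_formed_word L.
rewrite /singular_index_poly => -[mv|mv].
  rewrite (n_double_eq (double_passes_framed mv)).
  by rewrite !(index_poly_framed _ _ mv wK wL).
have := double_passes_rigid_gt0 mv; rewrite double_passesE //.
have nKL := n_double_eq (double_passes_rigid mv); rewrite -nKL.
case: (n_double K) (index_poly_rigid mv wK) => [|[|n]] // E _.
by rewrite E.
Qed.

Section Resolution.

Variables (x : nat) (w : code).

Lemma labs_resolve s : labs (resolve_word x s w) = labs w.
Proof.
rewrite -map_comp; apply: eq_map => p /=.
by case: eqP.
Qed.

(** The flow sees whether x is classical but not which branch is over. The index of y may therefore
    differ from that in [w], yet it is the same in both resolutions. *)
Lemma index_term_resolve f s y : y != x ->
  arc_flow y false (resolve_word x true w) =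
  arc_flow y false (resolve_word x s w) /\
  weight f y (resolve_word x s w) = weight f y w.
Proof.
move=> yx; split.
  elim: w false => //= p t IH b; rewrite !IH /flow_sign.
  by case: (lab p == x) => //=; case: (s); case: (frame p).
rewrite /weight big_map big_mkcond [RHS]big_mkcond; apply: eq_bigr => p _.
case: (eqVneq (lab p) x) => [->|//] /=.
by rewrite eq_sym (negbTE yx).
Qed.

Lemma arc_flow_resolve s : arc_flow x false (resolve_word x s w) = arc_flow x false w.
Proof.
elim: w false => //= p t IH b; case: (eqVneq (lab p) x) => [_|px] /=.
  by rewrite eqxx IH.
by rewrite (negbTE px) IH.
Qed.

Lemma crossings_double_resolve s :
  crossings is_double (resolve_word x s w) =
  [seq y <- crossings is_double w | y != x].
Proof.
rewrite /crossings filter_undup; congr undup.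
elim: w => //= p t IH; case: (eqVneq (lab p) x) => [px|px] /=.
  by case: eqP => _ /=; rewrite IH; case: (is_double _) => //=; rewrite px eqxx.
by case: (is_double _) => //=; rewrite px IH.
Qed.

End Resolution.

Lemma n_double_resolve x s (K : sdiagram) :
  x \in crossings is_double K -> n_double K = (n_double (resolve x s K)).+1.
Proof.
move=> xK; rewrite /n_double crossings_double_resolve size_filter.
rewrite -[in LHS](count_predC (pred1 x)) count_uniq_mem ?undup_uniq //.
by rewrite xK.
Qed.

Lemma index_poly_resolve_sum f x (K : sdiagram) s :
  index_poly f (resolve x s K) =
  \sum_(y <- undup (labs (word K))) index_term f y (resolve_word x s K).
Proof. by rewrite /index_poly labs_resolve. Qed.

Lemma weight_resolve_sign x s (K : sdiagram) : x \in labs (word K) ->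
  weight sign_weight x (resolve_word x s K) = if s then 1 else -1.
Proof.
move=> xK; case: (well_formed_paired x (well_formed_word K)) => [|].
  by rewrite xK.
move=> u p v q z Ew px qx fq kq xu xv xz.
have no t : x \notin labs t -> weight sign_weight x (resolve_word x s t) = 0.
  by move=> xt; rewrite weight_notin // labs_resolve.
rewrite Ew /resolve_word map_cat map_cons map_cat map_cons weight_cat weight_cons.
rewrite weight_cat weight_cons !no // px qx eqxx /= eqxx fq.
by case: (frame p); case: (s).
Qed.

Lemma weight_resolve_double x s (w : code) :
  weight double_weight x (resolve_word x s w) = 0.
Proof.
rewrite /weight big_map big1 // => p.
case: (eqVneq (lab p) x) => [_ _|/negbTE->//] /=.
by case: ifP.
Qed.

Lemma weight_double x w : well_formed w -> x \in crossings is_double w ->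
  weight double_weight x w = 1.
Proof.
move=> wfw; rewrite mem_undup => /mapP[r]; rewrite mem_filter => /andP[dr rw] xr.
case: (well_formed_paired x wfw) => [|]; first by rewrite xr map_f.
move=> u p v q z Ew px qx fq kq xu xv xz.
have dp : is_double (kind p).
  rewrite Ew in rw; case: (mem_pair xu xv xz rw (esym xr)) => [<-//|rq].
  by rewrite rq kq is_double_opp in dr.
rewrite Ew weight_cat weight_cons weight_cat weight_cons !(weight_notin _ _) //.
by rewrite px qx eqxx fq kq /double_weight is_double_opp dp; case: (frame p).
Qed.

Lemma singular_index_poly_skein (K : sdiagram) x :
  x \in crossings is_double K ->
  singular_index_poly K =
  singular_index_poly (resolve x true K) - singular_index_poly (resolve x false K).
Proof.
move=> xK; have wfK := well_formed_word K.
have xw : x \in labs (word K).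
  move: xK; rewrite mem_undup => /mapP[r]; rewrite mem_filter.
  by move=> /andP[_ rK] ->; apply: map_f.
have nt := n_double_resolve true xK; have nf := n_double_resolve false xK.
rewrite /singular_index_poly; move: (nt); rewrite nf => -[nft].
rewrite -nft.
case E : (n_double (resolve x false K)) => [|[|n]] //; last by rewrite subr0.
(* Here x is the only double point: its terms in the two resolutions have coefficients 1 and -1, and
   all other terms agree. *)
- rewrite [index_poly _ K]/index_poly !index_poly_resolve_sum -sumrB -sumrMnl.
  rewrite big_seq [RHS]big_seq; apply: eq_bigr => y; rewrite mem_undup => yK.
  have [->|yx] := eqVneq y x.
    rewrite /index_term !arc_flow_resolve weight_double //.
    by rewrite !weight_resolve_sign // scaleN1r opprK scale1r.
  rewrite /index_term.
  have [-> ->] := index_term_resolve K sign_weight false yx.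
  have [_ ->] := index_term_resolve K sign_weight true yx.
  rewrite subrr (weight_unseen (P := is_double)) ?scale0r ?mul0rn //.
    by case.
  move: xK; rewrite /n_double in nf E; move: nf; rewrite E.
  by case: (crossings _ _) => [|y' [|]] //; rewrite !inE => _ /eqP<-.
(* Here one double point remains after resolving x, and its index is the same in both
   resolutions. *)
apply/esym/eqP; rewrite subr_eq0; apply/eqP; congr (_ *+ 2).
rewrite !index_poly_resolve_sum; apply: eq_bigr => y _.
have [->|yx] := eqVneq y x.
  by rewrite /index_term !weight_resolve_double !scale0r.
rewrite /index_term.
have [-> ->] := index_term_resolve K double_weight false yx.
by have [_ ->] := index_term_resolve K double_weight true yx.
Qed.

Lemma singular_index_poly_agrees (K : diagram) :
  singular_index_poly (val K) = p_t K.
Proof. by rewrite p_tE /singular_index_poly (eqP (valP K)). Qed.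

(** * A singular knot showing that the order is not 0 *)

(** The figure-eight curve, a kink whose crossing is a double point. *)
Definition loop_word : code := [:: Pass 0 true Double; Pass 0 false Double].

(** Of the four darts, [face_step] fixes two, which bound the monogons, and swaps the other two,
    which bound the remaining region. This gives three faces for one vertex and two edges. *)
Lemma loop_genus0 : genus0 (shadow loop_word).
Proof.
set s := shadow loop_word.
suff faces3 : n_faces s = 3%N by rewrite /genus0 faces3.
pose i0 : 'I_(size s) := @Ordinal 2 0 isT.
pose i1 : 'I_(size s) := @Ordinal 2 1 isT.
have ordE (i : 'I_(size s)) : i = i0 \/ i = i1.
  by case: i => -[|[|]] // lti; [left|right]; apply: val_inj.
have op0 : other_pass i0 = i1.
  rewrite /other_pass; case: pickP => [j|/(_ i1)] //.
  by case: (ordE j) => ->.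
have op1 : other_pass i1 = i0.
  rewrite /other_pass; case: pickP => [j|/(_ i0)] //.
  by case: (ordE j) => ->.
have S0 : ordS i0 = i1 by apply: val_inj.
have S1 : ordS i1 = i0 by apply: val_inj.
have P0 : ord_pred i0 = i1 by apply: val_inj.
have P1 : ord_pred i1 = i0 by apply: val_inj.
have f0t : face_step (i0, true) = (i1, false) by rewrite /face_step S0 op1 /= P0.
have f0f : face_step (i0, false) = (i0, false) by rewrite /face_step op0 /= P1.
have f1t : face_step (i1, true) = (i1, true) by rewrite /face_step S1 op0.
have f1f : face_step (i1, false) = (i0, true) by rewrite /face_step op1.
have fK : involutive (@face_step s).
  by case=> i []; case: (ordE i) => ->; rewrite ?(f0t, f0f, f1t, f1f).
have fI : injective (@face_step s) := inv_inj fK.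
(* [A] collects the fixed darts; faces are counted separately on [A], with orbits of size 1, and on
   its complement, with orbits of size 2. *)
pose A := pred2 (i0, false) (i1, true).
have dartE d : d \in [:: (i0, false); (i1, true); (i0, true); (i1, false)].
  by case: d => i []; case: (ordE i) => ->.
have closedA : fclosed (@face_step s) A.
  move=> d d' /eqP<-; move: (dartE d); rewrite !inE.
  by move=> /or4P[] /eqP->; rewrite ?(f0t, f0f, f1t, f1f).
have fixedA : A \subset order_set (@face_step s) 1%N.
  apply/subsetP => d /pred2P dA.
  rewrite inE (@order_cycle _ _ [:: d]) ?inE //= andbT.
  by case: dA => ->; rewrite ?(f0f, f1t).
have swappedC : [predC A] \subset order_set (@face_step s) 2%N.
  apply/subsetP => d dA.
  rewrite inE (@order_cycle _ _ [:: d; face_step d]) ?mem_head //=.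
    by rewrite fK !eqxx.
  rewrite inE andbT; move: (dartE d) dA.
  by rewrite !inE => /or4P[] /eqP->; rewrite ?(f0t, f1f).
have cA : #|A| = 2%N by rewrite card2.
have cC : #|[predC A]| = 2%N.
  by apply/eqP; rewrite -(eqn_add2l #|A|) cardC cA card_prod card_ord card_bool.
have nA : fcard (@face_step s) A = 2%N.
  by rewrite -[LHS]muln1 (fcard_order_set fI fixedA closedA).
have nC : fcard (@face_step s) [predC A] = 1%N.
  apply/eqP; rewrite -(eqn_pmul2r (isT : 0 < 2)%N).
  by rewrite (fcard_order_set fI swappedC (predC_closed closedA)) cC.
by rewrite /n_faces (n_compC A) nA nC.
Qed.

Lemma loop_subproof : well_formed loop_word && genus0 (shadow loop_word).
Proof. by rewrite loop_genus0. Qed.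

Theorem proposition2 : framed_invariant p_t /\ vassiliev_order_one p_t.
Proof.
split=> [K L|].
  elim=> {K L} [K L mv|//|K L _ ->//|K L M _ -> _ ->//].
  rewrite !p_tE; apply: index_poly_framed mv _ _ => //; exact: well_formed_word.
split.
  exists singular_index_poly.
    split; first exact: singular_index_poly_equiv.
      exact: singular_index_poly_agrees.
    exact: singular_index_poly_skein.
  by move=> K; rewrite /singular_index_poly; case: (n_double K) => [|[]].
(* An extension of order 0 would vanish on the figure-eight curve, so p_t would agree on its two
   resolutions. These are single kinks of index 0, with values 1 and -1. *)
case=> V [_ agrees skein] V0.
pose K := SDiagram loop_subproof.
have xK : 0%N \in crossings is_double K by [].
have n0 s : n_double (resolve 0 s K) == 0%N by case: s.
pose Ks s : diagram := exist (fun L : sdiagram => n_double L == 0%N) _ (n0 s).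
have p_tKs s : p_t (Ks s) = (if s then 1 else -1)%:P.
  rewrite p_tE /index_poly /= big_seq1 /index_term /weight unlock.
  by case: s; rewrite /= ?addr0 ?add0r expr0 alg_polyC.
have := skein K 0%N xK; rewrite V0 //.
rewrite (agrees (Ks true)) (agrees (Ks false)) !p_tKs -polyCB.
by move=> /esym/eqP; rewrite polyC_eq0.
Qed.
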